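(* Let $\mathbb{F}$ be an algebraically closed field of prime characteristic $p$, let $G$ be a finite group and let $b$ be a block of $\mathbb{F}G$. Let $P_\alpha$ be a pointed $p$-group on $\mathbb{F}G$, and let $P{\uparrow}Q_\phi$ be the substantive generalized piece of $\mathbb{F}G$ corresponding to $P_\alpha$. Then the following three conditions are equivalent: (a) $P_\alpha$ is a pointed $p$-group on $\mathbb{F}Gb$; (b) $P{\uparrow}Q_\phi$ is a generalized piece of $\mathbb{F}Gb$; (c) $\mathrm{Dia}_G(P{\uparrow}Q_\phi)$ is isomorphic to a direct summand of the $\mathbb{F}(G\times P)$-module ${}_G(\mathbb{F}Gb)_P$.
   Context: Modules are finitely generated left modules. A block of $\mathbb{F}G$ is a primitive idempotent $b$ of the centre of $\mathbb{F}G$. For a finite group $L$, $\mathrm{Irr}(\mathbb{F}L)$ is the set of irreducible Brauer characters of $\mathbb{F}L$; for $\xi\in\mathrm{Irr}(\mathbb{F}L)$, $V(\xi)$ is a simple $\mathbb{F}L$-module with Brauer character $\xi$ and $E(\xi)$ is its projective cover. Pointed groups. A pointed group on $\mathbb{F}G$ is a pair $U_\mu$ where $U\le G$ and $\mu$ is a point of $U$, i.e. a conjugacy class, under the unit group of $(\mathbb{F}G)^U$, of primitive idempotents of $(\mathbb{F}G)^U$. It is a pointed $p$-group if $U$ is a $p$-group, and it is a pointed group on $\mathbb{F}Gb$ if $\mu\subseteq\mathbb{F}Gb$. Write $W_\omega\le U_\mu$ if $W\le U$ and for some (equivalently every) $i\in\mu$ there is $j\in\omega$ with $ij=ji=j$.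 For a $p$-subgroup $P$, $\mathrm{br}_P:(\mathbb{F}G)^P\to\mathbb{F}C_G(P)$ is the Brauer map (truncation of the support to $C_G(P)$); a pointed $p$-group $P_\gamma$ is local if $\mathrm{br}_P(i)\ne 0$ for $i\in\gamma$. A maximal local pointed subgroup of $P_\alpha$ is a maximal element among the local pointed groups $Q_\delta\le P_\alpha$. Pieces. A piece of $\mathbb{F}G$ is a pair $P_\theta$ with $P$ a $p$-subgroup of $G$ and $\theta\in\mathrm{Irr}(\mathbb{F}C_G(P))$. It is a piece of $\mathbb{F}Gb$ if $\mathrm{br}_P(b)$ acts as the identity on $E(\theta)$. By a theorem of Puig there is a bijection between local pointed groups $P_\gamma$ on $\mathbb{F}G$ and pieces $P_\theta$ of $\mathbb{F}G$, with $P_\gamma\leftrightarrow P_\theta$ if and only if $E(\theta)\cong\mathbb{F}C_G(P)\,\mathrm{br}_P(i)$ for $i\in\gamma$. A generalized piece $P{\uparrow}Q_\phi$ of $\mathbb{F}G$ is the equivalence class of a pair $(P,Q_\phi)$, where $P$ is a $p$-subgroup of $G$ and $Q_\phi$ is a piece of $\mathbb{F}G$ with $Q\le P$; pairs $(P,Q_\phi)$ and $(P',Q'_{\phi'})$ are equivalent if $P=P'$ and $Q_\phi,Q'_{\phi'}$ are $P$-conjugate. $P{\uparrow}Q_\phi$ is a generalized piece of $\mathbb{F}Gb$ if $Q_\phi$ is a piece of $\mathbb{F}Gb$. Substantivity. If a finite $p$-group $S$ acts by automorphisms on a finite group $K$ and $\eta\in\mathrm{Irr}(\mathbb{F}K)$,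 then $\eta_{\rtimes S}$ denotes the unique irreducible Brauer character of $\mathbb{F}(K\rtimes S)$ such that $E(\eta_{\rtimes S})\cong\mathrm{Ind}_K^{K\rtimes S}(E(\eta))$. For a generalized piece $P{\uparrow}Q_\phi$, put $\overline{P}=N_P(Q)/Q$, acting on $C_G(Q)$ by conjugation. $P{\uparrow}Q_\phi$ is substantive if the simple $\mathbb{F}(C_G(Q)\rtimes\overline{P})$-module $V(\phi_{\rtimes\overline{P}})$ restricts to an $\mathbb{F}\overline{P}$-module with a nonzero free direct summand. Diagonal modules. Let $\Delta(Q)=\{(y,y):y\in Q\}$, $N=N_{G\times P}(\Delta(Q))=(C_G(Q)\times 1)\Delta(N_P(Q))$ and $\overline{N}=N/\Delta(Q)\cong C_G(Q)\rtimes\overline{P}$, with $C_G(Q)$ embedded in $\overline N$ as $(C_G(Q)\times 1)\Delta(Q)/\Delta(Q)$. Let $\mathrm{Dia}^0_G(P{\uparrow}Q_\phi)$ be the inflation to $N$ of $\mathrm{Ind}_{C_G(Q)}^{\overline N}(E(\phi))$; it is indecomposable with vertex $\Delta(Q)$. The diagonal module $\mathrm{Dia}_G(P{\uparrow}Q_\phi)$ is the indecomposable $\mathbb{F}(G\times P)$-module with vertex $\Delta(Q)$ in Green correspondence with $\mathrm{Dia}^0_G(P{\uparrow}Q_\phi)$; up to isomorphism it does not depend on the choice of $Q_\phi$. The notation ${}_G M_P$ indicates that $G\times 1$ acts by left translation and $1\times P$ by right translation, i.e. $(g,u)x=gxu^{-1}$. Correspondence. There is a $G$-equivariant bijection between pointed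 $p$-groups $P_\alpha$ on $\mathbb{F}G$ and substantive generalized pieces $P{\uparrow}Q_\phi$ of $\mathbb{F}G$ (with the same $P$), characterized by either of the following equivalent conditions, where $Q_\delta$ is the local pointed group corresponding to $Q_\phi$ and $i\in\alpha$: $Q_\delta$ is a maximal local pointed subgroup of $P_\alpha$; or $\mathrm{Dia}_G(P{\uparrow}Q_\phi)\cong{}_G(\mathbb{F}Gi)_P$. This is the meaning of ''corresponding'' in the claim. *)

(* Defs.v *)
From HB Require Import structures.
From mathcomp Require Import all_boot all_order all_algebra all_fingroup.
From mathcomp Require Import all_solvable all_field all_character.

Set Implicit Arguments.
Unset Strict Implicit.
Unset Printing Implicit Defensive.

Import GroupScope GRing.Theory.
Local Open Scope ring_scope.

(* The ambient finite group G is the whole finGroupType gT, and its subgroups *)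
(* are the terms of type {group gT}.                                          *)

Section GroupAlgebra.

Variables (F : fieldType) (gT : finGroupType).

(* FG: the formal sum \sum_x a_x x is encoded by its coefficient function.    *)
(* The alias keeps the convolution product below apart from the pointwise     *)
(* product that {ffun gT -> F} carries in the library.                        *)
Definition galg : Type := {ffun gT -> F^o}.

HB.instance Definition _ := Vector.copy galg {ffun gT -> F^o}.

Implicit Types a b c : galg.

Definition gel (x : gT) : galg := [ffun y => (y == x)%:R].

Definition galg_mul a b : galg := [ffun x => \sum_y a y * b (y^-1 * x)%g].

Fact galg_mulA : associative galg_mul.
Proof.
move=> a b c; apply/ffunP=> x; rewrite !ffunE.
under eq_bigr do rewrite ffunE big_distrr /=.
under [RHS]eq_bigr do rewrite ffunE big_distrl /=.
rewrite [RHS]exchange_big /=; apply: eq_bigr => y _.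
rewrite [RHS](reindex_inj (mulgI y)) /=; apply: eq_bigr => z _.
by rewrite mulKg invMg mulrA mulgA.
Qed.

Fact galg_mul1l : left_id (gel 1%g) galg_mul.
Proof.
move=> a; apply/ffunP=> x; rewrite ffunE (bigD1 1%g) //= big1 => [|y /negPf ny].
  by rewrite ffunE eqxx mul1r invg1 mul1g addr0.
by rewrite ffunE ny mul0r.
Qed.

Fact galg_mul1r : right_id (gel 1%g) galg_mul.
Proof.
move=> a; apply/ffunP=> x; rewrite ffunE (bigD1 x) //= big1 => [|y ny].
  by rewrite ffunE mulVg eqxx mulr1 addr0.
by rewrite ffunE -eq_mulVg1 (negPf ny) mulr0.
Qed.

Fact galg_mulDl : left_distributive galg_mul +%R.
Proof.
move=> a b c; apply/ffunP=> x; rewrite !ffunE -big_split /=.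
by apply: eq_bigr => y _; rewrite !ffunE mulrDl.
Qed.

Fact galg_mulDr : right_distributive galg_mul +%R.
Proof.
move=> a b c; apply/ffunP=> x; rewrite !ffunE -big_split /=.
by apply: eq_bigr => y _; rewrite !ffunE mulrDr.
Qed.

Fact galg_1neq0 : gel 1%g != 0.
Proof. by apply/eqP=> /ffunP/(_ 1%g)/eqP; rewrite !ffunE eqxx oner_eq0. Qed.

HB.instance Definition _ := GRing.Zmodule_isNzRing.Build galg
  galg_mulA galg_mul1l galg_mul1r galg_mulDl galg_mulDr galg_1neq0.

Fact galg_scaleAl (k : F) a b : k *: (a * b) = (k *: a) * b.
Proof.
apply/ffunP=> x; rewrite !ffunE scaler_sumr.
by apply: eq_bigr => y _; rewrite !ffunE scalerAl.
Qed.

HB.instance Definition _ := GRing.Lmodule_isLalgebra.Build F galg galg_scaleAl.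

Fact galg_scaleAr (k : F) a b : k *: (a * b) = a * (k *: b).
Proof.
apply/ffunP=> x; rewrite !ffunE scaler_sumr.
by apply: eq_bigr => y _; rewrite !ffunE scalerAr.
Qed.

HB.instance Definition _ := GRing.Lalgebra_isAlgebra.Build F galg galg_scaleAr.

Definition idempotent_elt a := a * a = a.

Definition primitive_idempotent_in (S : galg -> Prop) e :=
  [/\ S e, idempotent_elt e, e <> 0
    & forall f g, S f -> S g -> idempotent_elt f -> idempotent_elt g ->
        f * g = 0 -> g * f = 0 -> e = f + g -> f = 0 \/ g = 0].

Definition galg_center a := forall c, a * c = c * a.

Definition is_block b := primitive_idempotent_in galg_center b.

(* The fixed algebra (FG)^U for the conjugation action of U. *)
Definition fixed_alg (U : {group gT}) a :=
  forall u, u \in U -> gel u * a * gel u^-1%g = a.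

Definition is_point (U : {group gT}) (mu : galg -> Prop) :=
  exists2 i, primitive_idempotent_in (fixed_alg U) i
    & forall j, mu j <->
        exists v w, [/\ fixed_alg U v, fixed_alg U w, v * w = 1, w * v = 1
                      & j = v * i * w].

Definition pointed_pgroup (p : nat) (P : {group gT}) (alpha : galg -> Prop) :=
  p.-group P /\ is_point P alpha.

(* The left ideal FGe; when e is central, it is the ideal FGe of FG. *)
Definition left_ideal e a := exists c, a = c * e.

Definition pointed_pgroup_on_block p b P alpha :=
  pointed_pgroup p P alpha /\ forall i, alpha i -> left_ideal b i.

(* An element of FC_G(Q) is seen as an element of FG supported on C_G(Q). *)
Definition brauer_map (Q : {group gT}) a : galg :=
  [ffun x => if x \in 'C(Q) then a x else 0].

End GroupAlgebra.

(* A left module of dimension n over FG is a matrix representation U of G     *)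
(* acting on the space 'cV[F]_n of column vectors by v |-> U x *m v. The      *)
(* library mostly lets representations act on row vectors on the right;       *)
(* mx_rsim, mx_irreducible, dadd_grepr and the characteristic polynomials of  *)
(* the U x do not depend on that choice.                                      *)

Section LeftModules.

Variables (F : fieldType) (gT : finGroupType) (G : {group gT}).
Local Notation rep n := (mx_representation F G n).

Definition left_hom m n (U : rep m) (V : rep n) (A : 'M[F]_(n, m)) :=
  forall x, x \in G -> A *m U x = V x *m A.

(* The left hom A : 'cV_m -> 'cV_n is surjective when its n rows are          *)
(* linearly independent.                                                      *)
Definition left_surj m n (A : 'M[F]_(n, m)) := row_free A.

Definition is_projective m (E : rep m) :=
  forall (V W : representation F G) s f,
    left_hom V W s -> left_surj s -> left_hom E W f ->
    exists2 h, left_hom E V h & s *m h = f.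

Definition is_projective_cover m n (E : rep m) (V : rep n) :=
  is_projective E /\
  exists s, [/\ left_hom E V s, left_surj s
    & forall (X : representation F G) h,
        left_hom X E h -> left_surj (s *m h) -> left_surj h].

Definition is_summand m n (U : rep m) (V : rep n) :=
  exists W : representation F G,
    mx_rsim V (dadd_grepr (Representation U) W).

Definition is_indecomposable n (V : rep n) :=
  (0 < n)%N /\ forall U W : representation F G,
    mx_rsim V (dadd_grepr U W) -> rdegree U = 0%N \/ rdegree W = 0%N.

(* The action of an element of FG, i.e. the value at a of the algebra map     *)
(* extending U.                                                               *)
Definition galg_op n (U : rep n) (a : galg F gT) : 'M[F]_n :=
  \sum_(x in G) a x *: U x.

Definition is_free n (V : rep n) :=
  exists k (e : 'I_k -> 'cV[F]_n), forall v : 'cV[F]_n,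
    exists! c : {ffun 'I_k -> galg F gT},
      (forall i x, x \notin G -> c i x = 0)
      /\ v = \sum_i galg_op V (c i) *m e i.

End LeftModules.

Section InducedModules.

Variables (F : fieldType).

Section Transport.

Variables (aT rT : finGroupType) (K : {group aT}) (f : {morphism K >-> rT}).
Hypothesis injf : 'injm f.
Variables (n : nat) (V : mx_representation F K n).

Definition injm_mx (y : rT) : 'M[F]_n := V (invm injf y).

Fact injm_mx_repr : mx_repr (f @* K) injm_mx.
Proof.
have mem_inv y : y \in f @* K -> invm injf y \in K.
  by case/morphimP=> x Kx _ ->; rewrite invmE.
split=> [|y z Ky Kz]; rewrite /injm_mx; first by rewrite morph1 repr_mx1.
by rewrite morphM // repr_mxM ?mem_inv.
Qed.

(* The module V transported along the isomorphism K -> f @* K. *)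
Definition injm_repr := MxRepresentation injm_mx_repr.

End Transport.

Section Ind.

Variables (gT : finGroupType) (H G : {group gT}) (sHG : H \subset G).
Variables (n : nat) (V : mx_representation F H n).

Definition lcoset_rep (i : 'I_#|lcosets H G|) : gT := repr (enum_val i).

(* FG (x)_FH V is the direct sum of the t_j (x) V, where t_j runs over        *)
(* representatives of the left cosets of H in G, and g (t_j (x) v) is         *)
(* t_i (x) (t_i^-1 g t_j) v for the i such that t_i^-1 g t_j is in H.         *)
Definition ind_mx (g : gT) : 'M[F]_(\sum_(i < #|lcosets H G|) n) :=
  \mxblock_(i < #|lcosets H G|, j < #|lcosets H G|)
     (let h := ((lcoset_rep i)^-1 * g * lcoset_rep j)%g in
      if h \in H then V h else 0).

Fact lcoset_repP i :
  lcoset_rep i \in G /\ enum_val i = (lcoset_rep i *: H)%g.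
Proof.
have /lcosetsP[x Gx defi] := enum_valP i.
have: lcoset_rep i \in (x *: H)%g.
  by rewrite /lcoset_rep defi; apply: mem_repr (lcoset_refl H x).
move=> tH; split; last by rewrite defi; apply/esym/lcoset_eqP.
by case/lcosetP: tH => h Hh ->; rewrite groupM // (subsetP sHG).
Qed.

Fact lcoset_rep_eq i j :
  ((lcoset_rep i)^-1 * lcoset_rep j \in H)%g = (i == j).
Proof.
apply/idP/eqP=> [|->]; last by rewrite mulVg group1.
rewrite -mem_lcoset => /lcoset_eqP eqij; apply: enum_val_inj.
by rewrite (lcoset_repP i).2 (lcoset_repP j).2.
Qed.

Fact lcoset_rep_ex g :
  g \in G -> exists k, ((lcoset_rep k)^-1 * g \in H)%g.
Proof.
move=> Gg; have gH : (g *: H)%g \in lcosets H G by apply/lcosetsP; exists g.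
exists (enum_rank_in gH (g *: H)%g); rewrite -mem_lcoset -(lcoset_repP _).2.
by rewrite enum_rankK_in ?lcoset_refl.
Qed.

Fact ind_mx_repr : mx_repr G ind_mx.
Proof.
split=> [|x y Gx Gy]; rewrite /ind_mx.
  rewrite -mxdiagZ; apply: eq_mxblock => i j /=.
  rewrite mulg1 lcoset_rep_eq.
  by have [->|//] := eqVneq; rewrite mulVg repr_mx1 conform_mx_id.
rewrite mul_mxblock; apply: eq_mxblock => i j /=.
have [Gj _] := lcoset_repP j.
have [k Hk] := lcoset_rep_ex (groupM Gy Gj).
have split_ij l : ((lcoset_rep i)^-1 * (x * y) * lcoset_rep j
    = (lcoset_rep i)^-1 * x * lcoset_rep l
        * ((lcoset_rep l)^-1 * y * lcoset_rep j))%g.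
  by rewrite !mulgA mulgK.
have Hk' : ((lcoset_rep k)^-1 * y * lcoset_rep j)%g \in H by rewrite -mulgA.
rewrite (split_ij k) (bigD1 k) //= big1 ?addr0 => [|l nlk].
  rewrite Hk' groupMr //.
  by case: ifP => Hik; rewrite ?mul0mx // repr_mxM.
case: (boolP (_ * lcoset_rep j \in H)%g) => [Hl|_]; last by rewrite mulmx0.
case/eqP: nlk; apply/eqP; rewrite -lcoset_rep_eq.
have -> : ((lcoset_rep l)^-1 * lcoset_rep k
    = (lcoset_rep l)^-1 * y * lcoset_rep j
        * ((lcoset_rep k)^-1 * y * lcoset_rep j)^-1)%g.
  by rewrite !invMg !mulgA mulgK mulgK invgK.
by rewrite groupM ?groupV.
Qed.

Definition ind_repr := MxRepresentation ind_mx_repr.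

End Ind.

End InducedModules.

Section Vertices.

Variables (F : fieldType) (gT : finGroupType).

Definition is_relatively_projective (G R : {group gT}) (sRG : R \subset G) n
    (M : mx_representation F G n) :=
  is_summand M (ind_repr sRG (subg_repr M sRG)).

(* A minimal subgroup relative to which M is projective; the vertices of an   *)
(* indecomposable M form a conjugacy class.                                   *)
Definition is_vertex (G R : {group gT}) n (M : mx_representation F G n) :=
  (exists sRG : R \subset G, is_relatively_projective sRG M)
  /\ forall (S : {group gT}) (sSG : S \subset G),
       S \subset R -> is_relatively_projective sSG M -> S :=: R.

(* N is meant to be the normalizer of R in G. *)
Definition green_correspondents (G N R : {group gT}) (sNG : N \subset G) m n
    (M : mx_representation F G m) (M0 : mx_representation F N n) :=
  [/\ is_indecomposable M, is_vertex R M, is_indecomposable M0, is_vertex R M0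
    & is_summand M0 (subg_repr M sNG)].

End Vertices.

Section BrauerCharacters.

Variables (F : closedFieldType) (p : nat).

Definition is_root_of_unity (R : nzRingType) (z : R) :=
  exists2 n, (0 < n)%N & n.-unity_root z.

(* An embedding of the group of roots of unity of F in the one of algC; its   *)
(* values elsewhere are irrelevant.                                           *)
Definition is_brauer_lift (lam : F -> algC) :=
  [/\ lam 1 = 1,
      forall x y, is_root_of_unity x -> is_root_of_unity y ->
        lam (x * y) = lam x * lam y
    & forall x y, is_root_of_unity x -> is_root_of_unity y ->
        lam x = lam y -> x = y].

Variable lam : F -> algC.
Variables (gT : finGroupType) (G : {group gT}).

Definition eigenvalues n (A : 'M[F]_n) : seq F :=
  sval (closed_field_poly_normal (char_poly A)).

(* Extended by zero outside the p-regular elements of G. *)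
Definition brauer_char n (V : mx_representation F G n) : {ffun gT -> algC} :=
  [ffun g => if (g \in G) && p^'.-elt g
             then \sum_(z <- eigenvalues (V g)) lam z else 0].

(* V is V(xi). *)
Definition simple_with_char (xi : {ffun gT -> algC}) n
    (V : mx_representation F G n) :=
  mx_irreducible V /\ brauer_char V = xi.

Definition Irr_brauer (xi : {ffun gT -> algC}) :=
  exists V : representation F G, simple_with_char xi V.

(* E is E(xi). *)
Definition proj_cover_with_char (xi : {ffun gT -> algC}) n
    (E : mx_representation F G n) :=
  exists2 V : representation F G, simple_with_char xi V
    & is_projective_cover E V.

End BrauerCharacters.

Section Semidirect.

Variables (F : closedFieldType) (p : nat) (lam : F -> algC).
Variables (aT rT : finGroupType) (S : {group aT}) (K : {group rT}).
Variable to : groupAction S K.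

(* K >| S is the whole of sdprod_groupType to, in which K is embedded by      *)
(* sdpair1 to and S by sdpair2 to.                                            *)
Definition ind_sdprod n (E : mx_representation F K n) :=
  ind_repr (subsetT (sdpair1 to @* K)) (injm_repr (injm_sdpair1 to) E).

(* zeta is eta_{>| S}, where E is E(eta). *)
Definition is_sdprod_char n (E : mx_representation F K n)
    (zeta : {ffun sdprod_groupType to -> algC}) :=
  exists2 E' : representation F [set: sdprod_groupType to],
    proj_cover_with_char p lam zeta E' & mx_rsim E' (ind_sdprod E).

Definition sdprod_substantive n (E : mx_representation F K n) :=
  exists zeta (V : representation F [set: sdprod_groupType to])
      (L : representation F (sdpair2 to @* S)),
    [/\ is_sdprod_char E zeta, simple_with_char p lam zeta V,
        is_free L, (0 < rdegree L)%N
      & is_summand L (subg_repr V (subsetT (sdpair2 to @* S)))].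

End Semidirect.

Section GeneralizedPieces.

Variables (F : closedFieldType) (p : nat) (lam : F -> algC).
Variable gT : finGroupType.
Implicit Types (P Q : {group gT}) (phi : {ffun gT -> algC}).

Definition is_piece Q phi := p.-group Q /\ Irr_brauer p lam 'C(Q) phi.

(* E is E(phi). *)
Definition is_piece_on_block (b : galg F gT) Q phi n
    (E : mx_representation F 'C(Q) n) :=
  is_piece Q phi /\ galg_op E (brauer_map Q b) = 1%:M.

(* The generalized piece given by the pair (P, Q_phi). *)
Definition is_generalized_piece P Q phi :=
  [/\ p.-group P, Q \subset P & is_piece Q phi].

Definition is_generalized_piece_on_block b P Q phi n
    (E : mx_representation F 'C(Q) n) :=
  is_generalized_piece P Q phi /\ is_piece_on_block b phi E.

Section Substantive.

Variables (P Q : {group gT}).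

(* The group P-bar; it acts on C_G(Q) by conjugation. *)
Definition quoN : {group coset_of Q} := ('N_P(Q) / Q)%G.

Fact quoN_sub : quoN \subset ([set: gT] / Q)%g.
Proof. by rewrite morphimS ?subsetT. Qed.

Definition conj_action := (('J %% Q) \ quoN_sub)%gact.

Fact centralizer_range : 'C(Q)%G :==: 'C_(|'J)(Q).
Proof. by rewrite gacentJ. Qed.

Definition is_substantive n (E : mx_representation F 'C(Q) n) :=
  sdprod_substantive p lam conj_action (eqg_repr E centralizer_range).

End Substantive.

End GeneralizedPieces.

Section DiagonalModules.

Variables (F : closedFieldType) (gT : finGroupType).
Variables (P Q : {group gT}).

Definition diag (x : gT) : gT * gT := (x, x).

Fact diagM : {in Q &, {morph diag : x y / (x * y)%g}}.
Proof. by []. Qed.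

Canonical diag_morphism := Morphism diagM.

Definition Delta : {group gT * gT} := (diag @* Q)%G.

Definition GxP : {group gT * gT} := setX_group [set: gT]%G P.

Definition norm_Delta : {group gT * gT} := 'N_GxP(Delta)%G.

Definition quo_norm_Delta : {group coset_of Delta} := (norm_Delta / Delta)%G.

Fact norm_Delta_sub : norm_Delta \subset GxP.
Proof. exact: subsetIl. Qed.

Fact norm_Delta_norm : norm_Delta \subset 'N(Delta).
Proof. exact: subsetIr. Qed.

Fact cent_norm_Delta : 'C(Q) \subset pairg1 gT @*^-1 'N(Delta).
Proof.
apply/subsetP=> c cQ; rewrite !inE /=.
apply/subsetP=> _ /imsetP[_ /morphimP[y Qy _ ->] ->].
have -> : (diag y ^ (c, 1) = diag y)%g; last by rewrite mem_morphim.
rewrite /conjg /diag; congr (_, _); last by rewrite /= invg1 mul1g mulg1.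
by rewrite /= -/(y ^ c)%g conjgE -(centP cQ y Qy) mulKg.
Qed.

(* The embedding of C_G(Q) in N / Delta(Q). *)
Definition cent_emb : {morphism 'C(Q) >-> coset_of Delta} :=
  [morphism of restrm cent_norm_Delta (coset Delta \o @pairg1 gT gT)].

Fact injm_cent_emb : 'injm cent_emb.
Proof.
apply: injm_restrm; rewrite /= ker_comp ker_coset.
apply/subsetP=> c /morphpreP[_ /morphimP[y _ Qy [-> <-]]].
exact: group1.
Qed.

Fact cent_emb_sub : cent_emb @* 'C(Q) \subset quo_norm_Delta.
Proof.
rewrite /= morphim_restrm setIid morphim_comp morphimS //.
apply/subsetP=> _ /morphimP[c nc cQ ->]; rewrite 2!inE /= !inE /= group1.
by case/morphpreP: (subsetP cent_norm_Delta _ cQ) => _; rewrite inE.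
Qed.

(* Dia^0_G(P|Q_phi), for E = E(phi). *)
Definition dia0_repr n (E : mx_representation F 'C(Q) n) :=
  morphim_repr (ind_repr cent_emb_sub (injm_repr injm_cent_emb E))
    norm_Delta_norm.

(* D is Dia_G(P|Q_phi), for E = E(phi). *)
Definition is_dia n (E : mx_representation F 'C(Q) n) d
    (D : mx_representation F GxP d) :=
  green_correspondents Delta norm_Delta_sub D (dia0_repr E).

(* M is isomorphic to the F(G x P)-module FGe; this makes sense when FGe is   *)
(* stable under right multiplication by P.                                    *)
Definition iso_bimodule (e : galg F gT) m (M : mx_representation F GxP m) :=
  exists f : {linear 'cV[F]_m -> galg F gT},
    [/\ injective f,
        forall a, left_ideal e a <-> exists v, a = f v
      & forall g u v, u \in P ->
          f (M (g, u) *m v) = gel F g * f v * gel F u^-1%g].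

(* P_alpha corresponds to the substantive generalized piece of which D is the *)
(* diagonal module when D is isomorphic to FGi for i in alpha. Any two        *)
(* elements i of alpha give isomorphic F(G x P)-modules FGi.                  *)
Definition corresponds (alpha : galg F gT -> Prop) d
    (D : mx_representation F GxP d) :=
  exists2 i, alpha i & iso_bimodule i D.

Definition is_summand_of_bimodule (e : galg F gT) d
    (D : mx_representation F GxP d) :=
  exists2 M : representation F GxP, iso_bimodule e M & is_summand D M.

End DiagonalModules.

(* Main.v *)
(* Let i be an element of alpha, so that D = FGi, and let c be central in FG. *)
(* Then c kills D exactly when c i = 0. If so, br_Q(c) kills E: the module    *)
(* Dia^0 is a direct summand of the restriction of D to N, say with inclusion *)
(* A and projection B, and as Delta(Q) acts trivially on Dia^0, the map       *)
(* x |-> c_x B x A is constant on the Q-conjugacy classes of G. In            *)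
(* characteristic p only the classes of size one, that is the elements of     *)
(* C_G(Q), contribute to 0 = B c A, so br_Q(c) kills Dia^0, whose restriction *)
(* to C_G(Q) contains E. As i is primitive, either b i = 0 or (1 - b) i = 0,  *)
(* and each of (a), (b), (c) amounts to (1 - b) i = 0: for (b) because E is   *)
(* nonzero, for (c) because FGb = FGi + FG(b - i) when b i = i.               *)

From HB Require Import structures.
Require Import Defs.
From mathcomp Require Import all_boot all_order all_algebra all_fingroup.
From mathcomp Require Import all_solvable all_field all_character.

Set Implicit Arguments.
Unset Strict Implicit.
Unset Printing Implicit Defensive.

Import GroupScope GRing.Theory.
Local Open Scope ring_scope.

(** All three conditions are compared with the single equation [(1 - b) * i1 = 0], where [i1] is the
    element of [alpha] with [D] isomorphic to FG[i1]. For a central element, [iso_bimodule_op]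
    translates the vanishing of its product with [i1] into the vanishing of its action on [D]. From
    there [brauer_op0] descends to E(phi) by an orbit count ([sum_pgroup_fix]), and [summand_op]
    passes from FG[b] to its summands. Conversely, [bimodule_exists] and [iso_bimodule_dadd] realise
    FG[b] as the sum of FG[i1] and a complement. *)

(** A nontrivial orbit of a p-group has size divisible by p, so it contributes a multiple of p times
    a constant, which is zero. *)
Lemma sum_pgroup_fix (F : fieldType) (V : lmodType F) (p : nat)
    (aT : finGroupType) (T : finType) (S : {group aT}) (to : {action aT &-> T})
    (h : T -> V) :
  p \in [pchar F] -> p.-group S ->
  (forall x y, y \in S -> h (to x y) = h x) ->
  \sum_x h x = \sum_(x in 'Fix_to(S)) h x.
Proof.
move=> charFp pS hto; rewrite (bigID (mem 'Fix_to(S))) /=.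
rewrite -[RHS]addr0; congr (_ + _).
rewrite (partition_big (orbit to S) predT) //= big1 // => O _.
case: (pickP (fun x => (x \notin 'Fix_to(S)) && (orbit to S x == O)));
  last first.
  by move=> no; rewrite big_pred0.
move=> x /andP[nfx /eqP <-{O}].
rewrite (eq_bigl (mem (orbit to S x))) => [|y] /=; last first.
  rewrite (sameP eqP orbit_eqP) andb_idl // => xy; apply: contra nfx.
  rewrite orbit_sym in xy => /orbit1P oy.
  by move: xy; rewrite oy => /set1P ->; apply/orbit1P.
rewrite (eq_bigr (fun=> h x)) => [|y]; last first.
  by case/orbitP=> z Sz <-; rewrite hto.
rewrite sumr_const -scaler_nat.
suff /eqP-> : #|orbit to S x|%:R == 0 :> F by rewrite scale0r.
rewrite -(dvdn_pcharf charFp).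
(* Exponent 0 would mean an orbit of size one, but [x] is not fixed. *)
have /p_natP[[|k] ok] : p.-nat #|orbit to S x|.
- exact: pnat_dvd (dvdn_orbit to S x) pS.
- by case/orbit1P: nfx; apply: card_orbit1.
by rewrite ok expnS dvdn_mulr.
Qed.

(** * Group elements and fixed elements in the group algebra *)

Section GroupAlgebra.

Variables (F : fieldType) (gT : finGroupType).
Implicit Types (a b e : galg F gT) (x y : gT).

Lemma gel1 : gel F (1%g : gT) = 1. Proof. by []. Qed.

Lemma gel_mulE x a y : (gel F x * a) y = a (x^-1 * y)%g.
Proof.
rewrite ffunE (bigD1 x) //= big1 ?addr0 => [|z /negPf nzx].
  by rewrite ffunE eqxx mul1r.
by rewrite ffunE nzx mul0r.
Qed.

Lemma mul_gelE a x y : (a * gel F x) y = a (y * x^-1)%g.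
Proof.
rewrite ffunE (bigD1 (y * x^-1)%g) //= big1 ?addr0 => [|z nz].
  by rewrite ffunE invMg invgK mulgKV eqxx mulr1.
rewrite ffunE; case: eqP => [zy|_]; last by rewrite mulr0.
by case/eqP: nz; rewrite -zy invMg invgK mulKVg.
Qed.

Lemma gelM x y : gel F (x * y)%g = gel F x * gel F y.
Proof.
apply/ffunP=> z; rewrite gel_mulE !ffunE.
by rewrite -[in RHS](inj_eq (mulgI x)) mulKVg.
Qed.

Lemma galg_sum a : a = \sum_x a x *: gel F x.
Proof.
apply/ffunP=> y; rewrite sum_ffunE (bigD1 y) //= big1 ?addr0 => [|x /negPf nx].
  by rewrite !ffunE eqxx [_ *: _]mulr1.
by rewrite !ffunE eq_sym nx scaler0.
Qed.

Lemma fixed_algC (U : {group gT}) a u :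
  fixed_alg U a -> u \in U -> a * gel F u = gel F u * a.
Proof.
move=> Ua uU; rewrite -[in LHS](Ua u uU) -!mulrA -gelM mulVg.
by rewrite gel1 mulr1.
Qed.

Lemma fixed_algE (U : {group gT}) a x u :
  fixed_alg U a -> u \in U -> a (x ^ u)%g = a x.
Proof.
move=> Ua uU; rewrite -{2}(Ua u uU) mul_gelE invgK gel_mulE.
by rewrite conjgE mulgA.
Qed.

Lemma fixed_alg_center (U : {group gT}) a : galg_center a -> fixed_alg U a.
Proof. by move=> Za u _; rewrite -Za -mulrA -gelM mulgV gel1 mulr1. Qed.

End GroupAlgebra.

(** Turns an abstract isomorphism with a direct sum into an equivariant inclusion [A] and projection
    [B], cut out of the isomorphism and its inverse. *)
Lemma summandP (F : fieldType) (gT : finGroupType) (G : {group gT}) m n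
    (U : mx_representation F G m) (V : mx_representation F G n) :
  is_summand U V ->
  exists (A : 'M_(n, m)) (B : 'M_(m, n)),
    [/\ B *m A = 1%:M, {in G, forall x, V x *m A = A *m U x},
        {in G, forall x, B *m V x = U x *m B}
      & {in G, forall x, B *m V x *m A = U x}].
Proof.
case=> W [C def_n]; subst n; rewrite row_free_unit => injC homC.
pose A := C *m col_mx 1%:M 0; pose B := row_mx 1%:M 0 *m invmx C.
have BA : B *m A = 1%:M.
  by rewrite mulmxA mulmxKV // mul_row_col mulmx1 mul0mx addr0.
have VA x : x \in G -> V x *m A = A *m U x.
  move=> Gx; rewrite mulmxA homC // -!mulmxA; congr (_ *m _).
  by rewrite /= mul_block_col mul_col_mx !mulmx1 !mul0mx !mulmx0 !mul1mx !addr0.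
have BV x : x \in G -> B *m V x = U x *m B.
  move=> Gx; apply: (can_inj (mulmxK injC)).
  rewrite -!mulmxA homC // mulKmx // mulVmx // mulmx1.
  by rewrite /= mul_row_block mul_mx_row !mulmx1 !mul0mx !mulmx0 !mul1mx !addr0.
by exists A, B; split=> // x Gx; rewrite BV // -mulmxA BA mulmx1.
Qed.

(** * The bimodules FGe, and the action of FG on diagonal modules *)

Section Bimodules.

Variables (F : closedFieldType) (gT : finGroupType) (P : {group gT}).
Implicit Types (a b e i : galg F gT) (x y : gT).

Definition left_op d (D : mx_representation F (GxP P) d) a : 'M[F]_d :=
  \sum_x a x *: D (x, 1%g).

Lemma mem_GxP x y : ((x, y) \in GxP P) = (y \in P).
Proof. by rewrite !inE. Qed.

(** Through the isomorphism, [a] acts by left multiplication on FGe. That module contains [e], and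
    by centrality [a] c e = c [a] e. *)
Lemma iso_bimodule_op e m (M : mx_representation F (GxP P) m) a :
  iso_bimodule e M -> galg_center a -> left_op M a = 0 <-> a * e = 0.
Proof.
case=> f [injf imf fM] Za.
have fop v : f (left_op M a *m v) = a * f v.
  rewrite /left_op mulmx_suml linear_sum [in RHS](galg_sum a) mulr_suml.
  apply: eq_bigr => x _; rewrite -scalemxAl linearZ /= fM ?group1 //.
  by rewrite invg1 gel1 mulr1 scalerAl.
split=> [op0 | ae0].
  have [v ->] : exists v, e = f v by apply/imf; exists 1; rewrite mul1r.
  by rewrite -fop op0 mul0mx linear0.
apply/matrixP=> k l; rewrite mxE.
have: left_op M a *m delta_mx l (0 : 'I_1) = 0.
  apply: injf; rewrite fop linear0.
  have /imf[c ->] : exists v', f (delta_mx l 0) = f v' by exists (delta_mx l 0).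
  by rewrite mulrA Za -mulrA ae0 mulr0.
by rewrite -colE => /matrixP/(_ k 0); rewrite !mxE.
Qed.

Lemma summand_op m (M : mx_representation F (GxP P) m) d
    (D : mx_representation F (GxP P) d) a :
  is_summand D M -> left_op M a = 0 -> left_op D a = 0.
Proof.
case/summandP=> A [B [_ _ _ eqD]] opM0.
transitivity (B *m left_op M a *m A); last by rewrite opM0 mulmx0 mul0mx.
rewrite /left_op mulmx_sumr mulmx_suml; apply: eq_bigr => x _.
by rewrite -scalemxAr -scalemxAl eqD // mem_GxP group1.
Qed.

(** FGe is the image of right multiplication by [e]; the matrices are written in a basis of this
    image. This provides the complement FG([b] - [i1]). *)
Lemma bimodule_exists e :
  e * e = e -> fixed_alg P e ->
  exists W : representation F (GxP P), iso_bimodule e W.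
Proof.
move=> ee Pe.
have mul_lin : linear (fun a : galg F gT => a * e).
  by move=> k a c; rewrite mulrDl scalerAl.
pose mul_e : {linear galg F gT -> galg F gT} :=
  HB.pack (fun a : galg F gT => a * e) (GRing.isLinear.Build _ _ _ _ _ mul_lin).
pose U : {vspace galg F gT} := limg (linfun mul_e).
have memU a : (a \in U) = (a * e == a).
  apply/memv_imgP/eqP=> [[c _ ->]|<-]; first by rewrite lfunE /= -mulrA ee.
  by exists a; rewrite ?memvf // lfunE.
have f_lin : linear (fun v : 'cV[F]_(\dim U) => \sum_j v j 0 *: (vbasis U)`_j).
  move=> k u v; rewrite scaler_sumr -big_split /=.
  by apply: eq_bigr => j _; rewrite !mxE scalerDl scalerA.
pose f : {linear 'cV[F]_(\dim U) -> galg F gT} :=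
  HB.pack (fun v : 'cV[F]_(\dim U) => \sum_j v j 0 *: (vbasis U)`_j)
    (GRing.isLinear.Build _ _ _ _ _ f_lin).
pose h a : 'cV[F]_(\dim U) := \col_j coord (vbasis U) j a.
have hK a : a \in U -> f (h a) = a.
  move=> Ua; rewrite {2}(coord_vbasis Ua) /=.
  by apply: eq_bigr => j _; rewrite mxE.
have fK : cancel f h.
  move=> v; apply/colP=> j; rewrite mxE /= coord_sum_free //.
  exact: basis_free (vbasisP U).
have fU v : f v \in U.
  apply: rpred_sum => j _; rewrite rpredZ //.
  by rewrite vbasis_mem // mem_nth // size_tuple.
(* Right multiplication by P preserves FGe because [e], being fixed by P, commutes with the elements
   of P. *)
have actU x y a : y \in P -> a \in U -> gel F x * a * gel F y^-1%g \in U.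
  rewrite !memU => Py /eqP ae; rewrite -mulrA -(fixed_algC Pe) ?groupV //.
  by rewrite mulrA -(mulrA _ a) ae.
pose act (x : gT * gT) : 'M[F]_(\dim U) :=
  \matrix_(j, k) h (gel F x.1 * (vbasis U)`_k * gel F (x.2)^-1%g) j 0.
have f_act (x : gT * gT) v : x \in GxP P ->
    f (act x *m v) = gel F x.1 * f v * gel F (x.2)^-1%g.
  case: x => x y; rewrite mem_GxP /= => Py.
  rewrite mulr_sumr mulr_suml.
  under eq_bigr do rewrite mxE scaler_suml.
  rewrite exchange_big /=; apply: eq_bigr => k _.
  rewrite -scalerAr -scalerAl.
  rewrite -[in RHS](hK (_ * _)) ?actU ?vbasis_mem ?mem_nth ?size_tuple //=.
  by rewrite scaler_sumr; apply: eq_bigr => j _; rewrite !mxE scalerA mulrC.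
have act_repr : mx_repr (GxP P) act.
  have mxP (A B : 'M[F]_(\dim U)) :
      (forall v : 'cV_(\dim U), f (A *m v) = f (B *m v)) -> A = B.
    move=> eqAB; apply/matrixP=> j k.
    have /(can_inj fK) := eqAB (delta_mx k 0).
    by rewrite -!colE => /matrixP/(_ j 0); rewrite !mxE.
  split=> [|x y Gx Gy]; apply: mxP => v.
    by rewrite f_act ?group1 //= invg1 gel1 mul1r mulr1 mul1mx.
  rewrite -mulmxA !f_act ?groupM //= invMg !gelM.
  by rewrite !mulrA.
exists (Representation (MxRepresentation act_repr)), f; split.
- exact: can_inj fK.
- move=> a; split=> [[c ->]|[v ->]]; last first.
    by exists (f v); apply/esym/eqP; rewrite -memU.
  by exists (h (c * e)); rewrite hK // memU -mulrA ee.
- by move=> x y v Py; apply: f_act; rewrite mem_GxP.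
Qed.

(** The diagonal block of the induced module at the coset [H] itself is [V], since [H] has
    representative 1. The indexing by [g] allows sums over C_G(Q) to be read through [cent_emb]. *)
Lemma ind_op0 (aT : finGroupType) (H K : {group aT}) (sHK : H \subset K) n
    (V : mx_representation F H n) (I : finType) (A : {pred I})
    (c : I -> F) (g : I -> aT) :
  {in A, forall k, g k \in H} ->
  \sum_(k in A) c k *: ind_repr sHK V (g k) = 0 ->
  \sum_(k in A) c k *: V (g k) = 0.
Proof.
move=> gH sum0.
have HK : (H : {set aT}) \in lcosets H K.
  by apply/lcosetsP; exists 1%g; rewrite ?group1 ?mul1g.
pose j := enum_rank_in HK H.
have repj : lcoset_rep j = 1%g :> aT.
  by rewrite /lcoset_rep enum_rankK_in ?repr_group.
move/(congr1 (fun M => submxblock M j j)): sum0.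
rewrite submxblock_sum submxblock0 => sum0; rewrite -[RHS]sum0.
apply: eq_bigr => k Ak.
have -> : V (g k) = submxblock (ind_repr sHK V (g k)) j j.
  by rewrite /= /ind_mx mxblockK /= repj invg1 mul1g mulg1 gH.
by apply/matrixP=> r s; rewrite !mxE.
Qed.

Lemma brauer_op0 p (Q : {group gT}) n (E : mx_representation F 'C(Q) n) d
    (D : mx_representation F (GxP P) d) a :
  p \in [pchar F] -> p.-group Q -> Q \subset P -> fixed_alg Q a ->
  is_summand (dia0_repr P E) (subg_repr D (norm_Delta_sub P Q)) ->
  left_op D a = 0 -> galg_op E (brauer_map Q a) = 0.
Proof.
move=> charFp pQ sQP Qa /summandP[A [B [_ DA BD eqD]]] opD0.
have NQ y : y \in Q -> (y, y) \in norm_Delta P Q.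
  move=> Qy; rewrite inE mem_GxP (subsetP sQP) //.
  by rewrite (subsetP (normG _)) // (mem_morphim (diag_morphism Q)).
have NC x : x \in 'C(Q) -> (x, 1%g) \in norm_Delta P Q.
  move=> Cx; rewrite inE mem_GxP group1.
  by have /morphpreP[] := subsetP (cent_norm_Delta Q) x Cx.
have diag1 y : y \in Q -> dia0_repr P E (y, y) = 1%:M.
  move=> Qy; rewrite /= /morphim_mx coset_id.
    exact: (repr_mx1 (ind_repr (cent_emb_sub P Q) _)).
  exact: (mem_morphim (diag_morphism Q)).
pose h x := a x *: (B *m D (x, 1%g) *m A).
have hQ x y : y \in Q -> h (x ^ y)%g = h x.
  move=> Qy; rewrite /h (fixed_algE _ Qa) //; congr (_ *: _).
  (* The outer factors lie in Delta(Q), so they move past [B] and [A] and then act trivially. *)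
  have -> : ((x ^ y)%g, 1%g) = ((y^-1, y^-1) * (x, 1) * (y, y))%g :> gT * gT.
    by rewrite conjgE; congr (_, _); rewrite /= ?mulgA // mulg1 mulVg.
  have Py := subsetP sQP y Qy.
  rewrite !repr_mxM ?groupM ?mem_GxP ?groupV ?group1 //.
  rewrite !mulmxA [B *m _]BD ?NQ ?groupV // -!mulmxA [D (y, y) *m A]DA ?NQ //.
  by rewrite !diag1 ?groupV // mul1mx mulmx1.
have: \sum_x h x = 0.
  transitivity (B *m left_op D a *m A); last by rewrite opD0 mulmx0 mul0mx.
  rewrite /left_op mulmx_sumr mulmx_suml; apply: eq_bigr => x _.
  by rewrite -scalemxAr -scalemxAl.
rewrite (sum_pgroup_fix (to := 'J) charFp pQ hQ) afixJ => sum0.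
(* For x in C_G(Q), (x, 1) normalizes Delta(Q), so its compression by [A] and [B] is its action on
   the inflated induced module. *)
have: \sum_(x in 'C(Q)) a x *:
    ind_repr (cent_emb_sub P Q) (injm_repr (injm_cent_emb Q) E) (cent_emb Q x)
  = 0.
  rewrite -[RHS]sum0; apply: eq_bigr => x Cx; congr (_ *: _).
  by rewrite [RHS]eqD ?NC.
move/ind_op0 => /=.
rewrite /galg_op => sumE; rewrite -[RHS]sumE.
  apply: eq_bigr => x Cx; rewrite ffunE Cx /= /injm_mx; congr (_ *: E _).
  by rewrite invmE.
by move=> x Cx; apply: mem_morphim.
Qed.

End Bimodules.

Lemma proj_cover_dim (F : fieldType) (gT : finGroupType) (G : {group gT}) m n
    (E : mx_representation F G m) (V : mx_representation F G n) :
  mx_irreducible V -> is_projective_cover E V -> (0 < m)%N.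
Proof.
case/mx_irrP=> n_gt0 _ [_ [s [_ s_surj _]]].
by apply: leq_trans n_gt0 _; rewrite -(eqP s_surj) rank_leq_col.
Qed.

(** Right multiplications by [e1] and [e2] are the two projections of FG([e1] + [e2]), which gives
    both injectivity and the image. *)
Lemma iso_bimodule_dadd (F : closedFieldType) (gT : finGroupType)
    (P : {group gT}) (e1 e2 : galg F gT) (M1 M2 : representation F (GxP P)) :
  e1 * e1 = e1 -> e2 * e2 = e2 -> e1 * e2 = 0 -> e2 * e1 = 0 ->
  iso_bimodule e1 M1 -> iso_bimodule e2 M2 ->
  iso_bimodule (e1 + e2) (dadd_grepr M1 M2).
Proof.
move=> e11 e22 e12 e21 [f1 [inj1 im1 act1]] [f2 [inj2 im2 act2]].
have f1e v : f1 v * e1 = f1 v /\ f1 v * e2 = 0.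
  have /im1[c ->] : exists v', f1 v = f1 v' by exists v.
  by rewrite -!mulrA e11 e12 mulr0.
have f2e v : f2 v * e2 = f2 v /\ f2 v * e1 = 0.
  have /im2[c ->] : exists v', f2 v = f2 v' by exists v.
  by rewrite -!mulrA e22 e21 mulr0.
have f_lin : linear (fun v : 'cV[F]_(rdegree M1 + rdegree M2) =>
    f1 (usubmx v) + f2 (dsubmx v)).
  by move=> k u v; rewrite !linearP scalerDr addrACA.
pose f : {linear 'cV[F]_(rdegree M1 + rdegree M2) -> galg F gT} :=
  HB.pack (fun v : 'cV[F]_(rdegree M1 + rdegree M2) =>
      f1 (usubmx v) + f2 (dsubmx v))
    (GRing.isLinear.Build _ _ _ _ _ f_lin).
exists f; split.
- move=> u v /= eq_uv; rewrite -[u]vsubmxK -[v]vsubmxK; congr col_mx.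
    apply: inj1; have:= congr1 ( *%R^~ e1) eq_uv.
    by rewrite /= !mulrDl !(f1e _).1 !(f2e _).2 !addr0.
  apply: inj2; have:= congr1 ( *%R^~ e2) eq_uv.
  by rewrite /= !mulrDl !(f1e _).2 !(f2e _).1 !add0r.
- move=> a; split=> [[c ->]|[v ->]] /=.
    have /im1[v1 eq1] : left_ideal e1 (c * e1) by exists c.
    have /im2[v2 eq2] : left_ideal e2 (c * e2) by exists c.
    by exists (col_mx v1 v2); rewrite mulrDr eq1 eq2 col_mxKu col_mxKd.
  exists (f1 (usubmx v) + f2 (dsubmx v)).
  rewrite mulrDr !mulrDl !(f1e _).1 !(f1e _).2 !(f2e _).1 !(f2e _).2.
  by rewrite addr0 add0r.
move=> x y v Py /=; rewrite -{1 2}[v]vsubmxK mul_block_col !mul0mx addr0 add0r.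
by rewrite col_mxKu col_mxKd act1 // act2 // mulrDr mulrDl.
Qed.

Theorem corollary2p9
  (F : closedFieldType) (p : nat) (charFp : p \in [pchar F])
  (lam : F -> algC) (lam_lift : is_brauer_lift lam)
  (gT : finGroupType)
  (b : galg F gT) (b_block : is_block b)
  (P : {group gT}) (alpha : galg F gT -> Prop)
  (alpha_pointed : pointed_pgroup p P alpha)
  (Q : {group gT}) (phi : {ffun gT -> algC})
  (phi_piece : is_generalized_piece p lam P Q phi)
  (n : nat) (E : mx_representation F 'C(Q) n)
  (E_phi : proj_cover_with_char p lam phi E)
  (phi_subst : is_substantive p lam P E)
  (d : nat) (D : mx_representation F (GxP P) d)
  (D_dia : is_dia E D)
  (alpha_phi : corresponds alpha D) :
  (pointed_pgroup_on_block p b P alpha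
     <-> is_generalized_piece_on_block p lam b P phi E)
  /\ (is_generalized_piece_on_block p lam b P phi E
        <-> is_summand_of_bimodule b D).
Proof.
case: alpha_pointed => pP [i [Pi ii i_neq0 i_prim] alphaE].
case: alpha_phi => i1 alpha1 isoD.
case: b_block => Zb bb _ _.
case: (phi_piece) => _ sQP pieceQ; case: (pieceQ) => pQ _.
case: D_dia => _ _ _ _ diaD.
case: E_phi => V [V_irr _] V_cover.
have [v [w [Pv Pw vw wv i1E]]] := (alphaE i1).1 alpha1.
have n_gt0 := proj_cover_dim V_irr V_cover.
have Zb' : galg_center (1 - b).
  by move=> c; rewrite mulrBl mulrBr mul1r mulr1 Zb.
have b'b' : (1 - b) * (1 - b) = 1 - b.
  by rewrite mulrBl mul1r mulrBr mulr1 bb subrr subr0.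
have bb' : b * (1 - b) = 0 by rewrite mulrBr mulr1 bb subrr.
(* Primitivity is stated for [i], the bimodule isomorphism for [i1]. Annihilation by a central
   element passes between the two, as they are conjugate. *)
have conj_i c j : galg_center c -> alpha j -> c * i = 0 -> c * j = 0.
  move=> Zc /alphaE[v' [w' [_ _ _ _ ->]]] ci0.
  by rewrite !mulrA Zc -(mulrA v') ci0 mulr0 mul0r.
have of_i1 c : galg_center c -> c * i1 = 0 -> c * i = 0.
  move=> Zc ci1; have -> : i = w * i1 * v.
    by rewrite i1E !mulrA wv mul1r -mulrA wv mulr1.
  by rewrite !mulrA Zc -(mulrA w) ci1 mulr0 mul0r.
have kill c : galg_center c -> c * i1 = 0 -> galg_op E (brauer_map Q c) = 0.
  move=> Zc /(iso_bimodule_op isoD Zc).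
  exact: (brauer_op0 charFp pQ sQP (fixed_alg_center Zc) diaD).
have op_compl :
    galg_op E (brauer_map Q (1 - b)) = 1%:M - galg_op E (brauer_map Q b).
  rewrite -(repr_mx1 E) /galg_op.
  have -> : E 1%g = \sum_(x in 'C(Q)) brauer_map Q (1 : galg F gT) x *: E x.
    rewrite (bigD1 1%g) ?group1 //= big1 ?addr0 => [|x /andP[Cx /negPf nx]].
      by rewrite !ffunE group1 eqxx scale1r.
    by rewrite !ffunE Cx nx scale0r.
  rewrite -sumrB; apply: eq_bigr => x Cx.
  by rewrite !ffunE Cx -scalerBl.
have aP : pointed_pgroup_on_block p b P alpha <-> (1 - b) * i1 = 0.
  split=> [[_ ab]|bi1].
    by have [c ->] := ab _ alpha1; rewrite Zb' -mulrA bb' mulr0.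
  split=> [|j aj]; first by split=> //; exists i.
  have:= conj_i _ _ Zb' aj (of_i1 _ Zb' bi1).
  by rewrite mulrBl mul1r => /subr0_eq bj; exists j; rewrite -Zb.
(* [b * i] and [(1 - b) * i] are orthogonal P-fixed idempotents with sum [i]. *)
have primP : (1 - b) * i1 = 0 \/ b * i1 = 0.
  have fixM c : galg_center c -> fixed_alg P (c * i).
    by move=> Zc u Pu; rewrite mulrA -Zc -(mulrA c) -(mulrA c) Pi.
  have idM c : galg_center c -> c * c = c -> idempotent_elt (c * i).
    move=> Zc cc; rewrite /idempotent_elt -mulrA (mulrA i) -(Zc i) -mulrA.
    by rewrite [i * i]ii mulrA cc.
  have orth c c' : galg_center c' -> c * c' = 0 -> c * i * (c' * i) = 0.
    by move=> Zc' cc'; rewrite -mulrA (mulrA i) -Zc' -mulrA ii mulrA cc' mul0r.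
  have b'b : (1 - b) * b = 0 by rewrite -Zb.
  have [] := i_prim (b * i) ((1 - b) * i) (fixM _ Zb) (fixM _ Zb')
    (idM _ Zb bb) (idM _ Zb' b'b') (orth _ _ Zb' bb') (orth _ _ Zb b'b).
  - by rewrite -mulrDl addrC subrK mul1r.
  - by move/(conj_i _ _ Zb alpha1); right.
  - by move/(conj_i _ _ Zb' alpha1); left.
have bP : is_generalized_piece_on_block p lam b P phi E <-> (1 - b) * i1 = 0.
  split=> [[_ [_ opb]]|bi1].
    (* If [b * i1 = 0], then br_Q([b]) acts on E(phi) both as 0 and as the identity; [n_gt0]
       supplies a diagonal entry with 1 = 0. *)
    case: primP => // /(kill _ Zb); rewrite opb => /matrixP.
    move/(_ (Ordinal n_gt0) (Ordinal n_gt0))/eqP.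
    by rewrite !mxE eqxx oner_eq0.
  by do 2!split=> //; apply/esym/subr0_eq; rewrite -op_compl kill.
have cP : is_summand_of_bimodule b D <-> (1 - b) * i1 = 0.
  split=> [[M isoM DM]|bi1].
    apply/(iso_bimodule_op isoD Zb')/(summand_op DM)/(iso_bimodule_op isoM Zb').
    by rewrite -Zb.
  have bi : b * i1 = i1 by move: bi1; rewrite mulrBl mul1r => /subr0_eq.
  have i1i1 : i1 * i1 = i1.
    by rewrite i1E !mulrA -(mulrA _ w) wv mulr1 -(mulrA v) ii.
  have Pi1 : fixed_alg P i1.
    move=> u Pu; rewrite i1E !mulrA -(fixed_algC Pv Pu) -(mulrA v).
    rewrite -(fixed_algC Pi Pu) -!mulrA; do 2!congr (_ * _).
    by rewrite mulrA -(fixed_algC Pw Pu) -mulrA -gelM mulgV gel1 mulr1.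
  have Pbi1 : fixed_alg P (b - i1).
    move=> u Pu; rewrite mulrBr mulrBl Pi1 //.
    by rewrite (fixed_alg_center Zb Pu).
  have i1b : i1 * b = i1 by rewrite -Zb.
  have id_bi1 : (b - i1) * (b - i1) = b - i1.
    by rewrite mulrBl !mulrBr bb bi i1b i1i1 subrr subr0.
  have [W isoW] := bimodule_exists id_bi1 Pbi1.
  (* [W] realises FG([b] - [i1]), and [b] is the sum of the orthogonal idempotents [i1] and
     [b - i1]. *)
  exists (dadd_grepr (Representation D) W).
    rewrite -[b](subrKC i1); apply: iso_bimodule_dadd => //.
    - by rewrite mulrBr i1b i1i1 subrr.
    - by rewrite mulrBl bi i1i1 subrr.
  by exists W; apply: mx_rsim_refl.
by split; [apply: iff_trans aP (iff_sym bP) | apply: iff_trans bP (iff_sym cP)].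
Qed.
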